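(* Let $G$ be a connected graph of order $n$. Then $pd_s(G)=n$ if and only if $G$ is a complete graph.
   Context: Graphs are finite, simple, connected; $d_G$ is shortest-path distance, $d_G(x,W)=\min\{d_G(x,w):w\in W\}$. A set $W$ strongly resolves different vertices $x,y\notin W$ if $d_G(x,W)=d_G(x,y)+d_G(y,W)$ or $d_G(y,W)=d_G(y,x)+d_G(x,W)$. A vertex partition $\Pi$ is a strong resolving partition if every two different vertices in the same set of $\Pi$ are strongly resolved by some set of $\Pi$; the strong partition dimension $pd_s(G)$ is the minimum cardinality of such a partition. *)

(* Defs.v *)
From mathcomp Require Import all_boot.
Set Implicit Arguments.
Unset Strict Implicit.
Unset Printing Implicit Defensive.

Record sgraph := SGraph {
  vertex :> finType;
  adj : rel vertex;
  adj_sym : symmetric adj;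
  adj_irr : irreflexive adj }.

Definition connected_graph (G : sgraph) : Prop :=
  forall x y : G, connect (@adj G) x y.

Definition complete_graph (G : sgraph) : Prop :=
  forall x y : G, x != y -> adj x y.

(* [x :: p] is a path of length [size p = k], with pairwise distinct
   vertices, from [x] to [y]. *)
Definition has_path (G : sgraph) (x y : G) (k : nat) : bool :=
  [exists p : k.-tuple G,
    [&& path (@adj G) x p, uniq (x :: p) & last x p == y]].

(* A path has length less than [#|G|], so nothing is lost by bounding [k]; the
   default value [#|G|] is only reached when there is no path from [x] to [y]
   (see [dist_attained] and [dist_min]). *)
Definition dist (G : sgraph) (x y : G) : nat :=
  \big[minn/#|G|]_(k < #|G| | has_path x y k) k.

(* In a connected graph the default value exceeds all distances, hence plays
   no role when [W] is nonempty (see [set_dist_attained] and [set_dist_min]);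
   the members of a partition are nonempty. *)
Definition set_dist (G : sgraph) (x : G) (W : {set G}) : nat :=
  \big[minn/#|G|]_(w in W) dist x w.

Definition strongly_resolves (G : sgraph) (W : {set G}) (x y : G) : bool :=
  [&& x != y, x \notin W, y \notin W &
      (set_dist x W == dist x y + set_dist y W)
   || (set_dist y W == dist y x + set_dist x W)].

Definition strong_resolving_partition (G : sgraph) (P : {set {set G}}) : bool :=
  partition P [set: G] &&
  [forall A in P, forall x in A, forall y in A,
     (x != y) ==> [exists W in P, strongly_resolves W x y]].

Lemma exists_strong_resolving_partition (G : sgraph) :
  exists k, [exists P : {set {set G}},
    strong_resolving_partition P && (#|P| == k)].
Proof.
pose P := [set [set x] | x : G].
exists #|P|; apply/existsP; exists P; rewrite eqxx andbT.
apply/andP; split; last first.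
  apply/forall_inP => A /imsetP [a _ ->].
  apply/forall_inP => x /set1P ->; apply/forall_inP => y /set1P ->.
  by rewrite eqxx.
apply/and3P; split.
- rewrite /cover eqEsubset subsetT /=; apply/subsetP => x _.
  apply/bigcupP; exists [set x]; last exact: set11.
  by apply/imsetP; exists x.
- apply/trivIsetP => A B /imsetP [a _ ->] /imsetP [b _ ->] neq_ab.
  rewrite disjoints1 in_set1; apply: contra neq_ab.
  by move=> /eqP ->.
- by apply/imsetP => [[x _ /setP /(_ x)]]; rewrite set11 in_set0.
Qed.

Definition strong_partition_dimension (G : sgraph) : nat :=
  ex_minn (exists_strong_resolving_partition G).

Lemma bigminn_le (I : finType) (Q : pred I) (F : I -> nat) m i :
  Q i -> \big[minn/m]_(j | Q j) F j <= F i.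
Proof.
move=> Qi; have := mem_index_enum i; elim: index_enum => //= j s IHs.
rewrite inE big_cons => /predU1P [<- | /IHs le_i]; first by rewrite Qi geq_minl.
by case: ifP => // _; rewrite geq_min le_i orbT.
Qed.

Lemma bigminn_attained (I : finType) (Q : pred I) (F : I -> nat) m :
    \big[minn/m]_(j | Q j) F j < m ->
  exists2 i, Q i & \big[minn/m]_(j | Q j) F j = F i.
Proof.
elim/big_rec: _ => [|i k Qi IHk]; first by rewrite ltnn.
rewrite /minn; case: (ltnP (F i) k) => _ lt_m; first by exists i.
exact: IHk.
Qed.

Lemma has_path_lt (G : sgraph) (x y : G) k : has_path x y k -> k < #|G|.
Proof.
case/existsP=> p /and3P [_ /card_uniqP /= card_p _].
by have := max_card [in x :: p]; rewrite card_p size_tuple.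
Qed.

Lemma dist_min (G : sgraph) (x y : G) k : has_path x y k -> dist x y <= k.
Proof.
move=> pk; have k_lt := has_path_lt pk.
by apply: (@bigminn_le _ _ _ _ (Ordinal k_lt)).
Qed.

Lemma dist_attained (G : sgraph) (x y : G) :
  connected_graph G -> has_path x y (dist x y).
Proof.
move=> connG; have /connectP [p0 e_p0 ->] := connG x y.
case/shortenP: e_p0 => p e_p uniq_p _.
have pk : has_path x (last x p) (size p).
  by apply/existsP; exists (in_tuple p); rewrite e_p uniq_p eqxx.
have lt_d := leq_ltn_trans (dist_min pk) (has_path_lt pk).
by have [i Qi Ei] := bigminn_attained lt_d; rewrite /dist Ei.
Qed.

Lemma set_dist_min (G : sgraph) (x w : G) (W : {set G}) :
  w \in W -> set_dist x W <= dist x w.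
Proof. exact: bigminn_le. Qed.

Lemma set_dist_attained (G : sgraph) (x : G) (W : {set G}) :
    connected_graph G -> W != set0 ->
  exists2 w, w \in W & set_dist x W = dist x w.
Proof.
move=> connG /set0Pn [w Ww]; apply: bigminn_attained.
apply: leq_ltn_trans (set_dist_min x Ww) _.
exact: has_path_lt (dist_attained x w connG).
Qed.

(* Main.v *)
Require Import Defs.
From mathcomp Require Import all_boot.

(* In a complete graph every vertex is at distance 1 from every set of a
   partition not containing it, so no set strongly resolves two vertices and
   all sets are singletons.  If x and y are distinct and not adjacent, let a
   be the vertex following x on a shortest path to y: then [set y] strongly
   resolves x and a, so that [set x; a] and the remaining singletons form a
   strong resolving partition with one set less than there are vertices. *)

(** [dist] only ranges over paths without repeated vertices. Shortening a walk to such a path uses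
    only vertices of the walk, so the length does not grow. *)
Lemma dist_path (G : sgraph) (x : G) (p : seq G) :
  path (@adj G) x p -> dist x (last x p) <= size p.
Proof.
case/shortenP=> q e_q uniq_q sub_qp.
have /andP [_ uq] := uniq_q.
apply: leq_trans (uniq_leq_size uq sub_qp).
by apply/dist_min/existsP; exists (in_tuple q); rewrite e_q uniq_q eqxx.
Qed.

Lemma shortest_path (G : sgraph) (x y : G) :
  connected_graph G ->
  exists p, [/\ path (@adj G) x p, last x p = y & size p = dist x y].
Proof.
move=> connG; have /existsP [p /and3P [e_p _ /eqP py]] := dist_attained x y connG.
by exists p; rewrite size_tuple.
Qed.

Lemma dist_triangle (G : sgraph) (x y z : G) :
  connected_graph G -> dist x z <= dist x y + dist y z.
Proof.
move=> connG.
have [p [e_p py <-]] := shortest_path _ x y connG.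
have [q [e_q qz <-]] := shortest_path _ y z connG.
have := @dist_path G x (p ++ q).
by rewrite cat_path e_p py e_q last_cat py qz size_cat; apply.
Qed.

Lemma dist_adj (G : sgraph) (x y : G) :
  connected_graph G -> adj x y -> dist x y = 1.
Proof.
move=> connG xy; apply/eqP; rewrite eqn_leq.
have -> /= : dist x y <= 1 by apply: (@dist_path G x [:: y]); rewrite /= xy.
have [[|z p] [_ /= py <-]] // := shortest_path _ x y connG.
by rewrite -py adj_irr in xy.
Qed.

Lemma set_dist1 (G : sgraph) (x y : G) :
  connected_graph G -> set_dist x [set y] = dist x y.
Proof.
move=> connG.
have [|w /set1P -> ->] // := set_dist_attained x (W := [set y]) connG.
by apply/set0Pn; exists y; rewrite set11.
Qed.

Lemma complete_set_dist (G : sgraph) (x : G) (W : {set G}) :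
    connected_graph G -> complete_graph G -> W != set0 -> x \notin W ->
  set_dist x W = 1.
Proof.
move=> connG compG W0 xW; have [w Ww ->] := set_dist_attained x connG W0.
by apply/dist_adj/compG => //; apply: contraNneq xW => ->.
Qed.

(** All three distances involved are 1, so either alternative would read 1 = 1 + 1. *)
Lemma complete_not_strongly_resolves (G : sgraph) (W : {set G}) (x y : G) :
    connected_graph G -> complete_graph G -> W != set0 ->
  ~~ strongly_resolves W x y.
Proof.
move=> connG compG W0; apply/negP => /and4P [xy xW yW].
by rewrite !complete_set_dist // !dist_adj //; apply: compG; rewrite // eq_sym.
Qed.

Lemma complete_card_partition (G : sgraph) (P : {set {set G}}) :
    connected_graph G -> complete_graph G -> strong_resolving_partition P ->
  #|P| = #|G|.
Proof.
move=> connG compG /andP [partP /forall_inP resP].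
have nonempty A : A \in P -> A != set0.
  by move=> PA; apply: contraTneq PA => ->; case/and3P: partP.
(* Both cardinals become sums over the blocks, of 1 and of [#|A|], compared term by term. *)
rewrite -cardsT (card_partition partP) -sum1_card; apply: eq_bigr => A PA.
apply/eqP; rewrite eq_sym eqn_leq card_gt0 nonempty // andbT leqNgt.
apply/negP => /card_gt1P [x [y [Ax Ay xy]]].
move/forall_inP/(_ x Ax)/forall_inP/(_ y Ay)/implyP/(_ xy): (resP A PA).
case/exists_inP=> W PW; apply/negP.
exact: complete_not_strongly_resolves _ _ _ _ connG compG (nonempty _ PW).
Qed.

Lemma shortest_path_neighbour (G : sgraph) (x y : G) :
    connected_graph G -> x != y -> ~~ adj x y ->
  exists a, [/\ adj x a, a != y & dist x y = dist x a + dist a y].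
Proof.
move=> connG xy nxy.
have [[|a p] [/= e_p py dxy]] := shortest_path _ x y connG.
  by rewrite py eqxx in xy.
case/andP: e_p => xa e_p; exists a; split=> //.
  by apply: contraNneq nxy => <-.
(* For the other inequality, the rest [p] of the shortest path leads from [a] to [y] in
   [dist x y - 1] steps. *)
apply/eqP; rewrite eqn_leq dist_triangle //= -dxy dist_adj // add1n ltnS -py.
exact: dist_path.
Qed.

Lemma strong_resolving_partition_merge (G : sgraph) (x a y : G) :
    connected_graph G -> x != a -> y != x -> y != a ->
    dist x y = dist x a + dist a y ->
  exists2 P : {set {set G}}, strong_resolving_partition P & #|P| < #|G|.
Proof.
move=> connG xa yx ya dxy.
(* The fibres of [f] are the pair of [x] and [a] and the remaining singletons. *)
pose f z := if z == a then x else z.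
have fE u v : f u = f v -> [|| u == v, (u == x) && (v == a) | (u == a) && (v == x)].
  rewrite /f; case: (u =P a) => [->|_]; case: (v =P a) => [->|_].
  - by rewrite eqxx.
  - by move=> <-; rewrite eqxx !orbT.
  - by move=> ->; rewrite eqxx !orbT.
  - by move=> ->; rewrite eqxx.
pose g z := [set w in [set: G] | f z == f w].
exists (preim_partition f [set: G]); last first.
  (* The block of [a] is also that of [x], so the vertices other than [a] already yield all
     blocks. *)
  have: preim_partition f [set: G] \subset g @: [set~ a].
    apply/subsetP => A /imsetP [z _ ->].
    have [->|za] := eqVneq z a; last by apply: imset_f; rewrite !inE.
    apply/imsetP; exists x; first by rewrite !inE.
    by apply/setP => w; rewrite !inE /f eqxx (negPf xa).
  move/subset_leq_card => le_P; apply: leq_ltn_trans le_P _.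
  apply: leq_ltn_trans (leq_imset_card _ _) _.
  by rewrite cardsC1 ltn_predL; apply/card_gt0P; exists a.
apply/andP; split; first exact: preim_partitionP.
have yP : [set y] \in preim_partition f [set: G].
  apply/imsetP; exists y => //; apply/setP => w; rewrite !inE.
  apply/eqP/eqP => [-> //|/fE].
  by rewrite (negPf yx) (negPf ya) !orbF => /eqP.
apply/forall_inP => A /imsetP [z _ ->].
apply/forall_inP => u; rewrite !inE => /eqP zu.
apply/forall_inP => v; rewrite !inE => /eqP zv.
apply/implyP => uv; apply/exists_inP; exists [set y] => //.
rewrite /strongly_resolves uv !inE !set_dist1 //=.
(* Distinct [u] and [v] in one block are [x] and [a] in some order; the order decides which
   alternative [dxy] proves. *)
have := fE u v; rewrite -zu -zv (negPf uv) => /(_ erefl) /=.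
by case/orP=> /andP [/eqP -> /eqP ->];
  rewrite ![_ == y]eq_sym yx ya dxy eqxx ?orbT.
Qed.

Theorem theorem16 (G : sgraph) (n : nat) (hconn : connected_graph G)
    (horder : #|G| = n) :
  strong_partition_dimension G = n <-> complete_graph G.
Proof.
rewrite -horder /strong_partition_dimension; case: ex_minnP => k.
case/existsP=> P /andP [resP /eqP cardP] min_k; split; last first.
  by move=> compG; rewrite -cardP; apply: complete_card_partition.
move=> kE x y xy; apply: contraT => nxy.
have [a [xa ay dxy]] := shortest_path_neighbour _ x y hconn xy nxy.
have neq_xa : x != a by apply: contraTneq xa => ->; rewrite adj_irr.
have [||Q resQ] := strong_resolving_partition_merge _ x a y hconn neq_xa _ _ dxy.
- by rewrite eq_sym.
- by rewrite eq_sym.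
(* [Q] has fewer than [k] blocks, against the minimality of [k]. *)
rewrite -kE ltnNge min_k //.
by apply/existsP; exists Q; rewrite resQ eqxx.
Qed.
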